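(* Let $p$ be a prime, $b\ge1$ an integer, $R=\mathbb{Z}_p[x]/\langle x^{2b+1}\rangle$, and $\varGamma(R)$ its zero-divisor graph, with vertex partition $V(\varGamma(R))=\bigcup_{i=1}^{2b}V_i$, $V_i=\{\sum_{k=i}^{2b}a_kx^k:a_i\ne0\}$, $n_i=|V_i|=(p-1)p^{2b-i}$. Put $d_i=p^i-1$ for $1\le i\le b$ and $d_i=p^i-2$ for $b+1\le i\le 2b$ (the common degree of vertices in $V_i$). Let $Q^*=(Q^*_{ij})_{1\le i,j\le 2b}$ with $Q^*_{ii}=0$ for $1\le i\le b$, $Q^*_{ii}=n_i-1$ for $b+1\le i\le 2b$, and for $i\ne j$: $Q^*_{ij}=n_j$ if $i+j\ge 2b+1$, $Q^*_{ij}=0$ if $i+j\le 2b$. Let $D^*=\mathrm{diag}(d_1,\dots,d_{2b})$ and $B=\alpha D^*+(1-\alpha)Q^*$, $0\le\alpha\le1$. Then the spectrum (as a multiset) of $A_\alpha(\varGamma(R))$ consists of the eigenvalue $\alpha(p^i-1)$ for each $1\le i\le b$ and the eigenvalue $\alpha(p^i-1)-1$ for each $b+1\le i\le 2b$, each with multiplicity $n_i-1=(p-1)p^{2b-i}-1$, together with the $2b$ eigenvalues of the $2b\times 2b$ matrix $B$.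
   Context: The zero-divisor graph $\varGamma(R)$ has vertex set the nonzero zero-divisors of $R$, distinct $x,y$ adjacent iff $xy=0$. For a graph $G$ with adjacency matrix $A(G)$ and diagonal degree matrix $D(G)$, $A_\alpha(G)=\alpha D(G)+(1-\alpha)A(G)$ for $0\le\alpha\le1$. $Q^*$ is the quotient matrix of $A(\varGamma(R))$ with respect to the partition $\{V_i\}$. *)

(* Defs.v *)
From HB Require Import structures.
From mathcomp Require Import all_boot all_order all_algebra.
From mathcomp Require Import qpoly reals.

Set Implicit Arguments.
Unset Strict Implicit.
Unset Printing Implicit Defensive.

Import Order.TTheory GRing.Theory Num.Theory.
Local Open Scope ring_scope.

Record sgraph (T : finType) := SGraph {
  vertices : {set T};
  adj : rel T;
  adj_sym : symmetric adj;
  adj_irr : irreflexive adj }.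

Section GraphMatrices.
Variables (F : fieldType) (T : finType) (G : sgraph T).

Definition degree (x : T) : nat := #|[set y in vertices G | adj G x y]|.

Definition adjmx : 'M[F]_#|vertices G| :=
  \matrix_(i, j) (adj G (enum_val i) (enum_val j))%:R.

Definition degmx : 'M[F]_#|vertices G| :=
  diag_mx (\row_i (degree (enum_val i))%:R).

Definition Aalpha (alpha : F) : 'M[F]_#|vertices G| :=
  alpha *: degmx + (1 - alpha) *: adjmx.

(* The (i, j) entry is the average row sum of the (P i, P j) block of M. *)
Definition quotient_mx (m : nat) (M : 'M[F]_#|vertices G|)
    (P : 'I_m -> {set T}) : 'M[F]_m :=
  \matrix_(i, j)
    ((\sum_(k | enum_val k \in P i) \sum_(l | enum_val l \in P j) M k l)
       / #|P i|%:R).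

End GraphMatrices.

(* s lists all eigenvalues of M, with algebraic multiplicity; in particular
   M has all its eigenvalues in F. *)
Definition is_spectrum (F : fieldType) (n : nat) (M : 'M[F]_n) (s : seq F) :=
  char_poly M = \prod_(a <- s) ('X - a%:P).

Lemma is_spectrum_uniq (F : fieldType) (n : nat) (M : 'M[F]_n) (s t : seq F) :
  is_spectrum M s -> is_spectrum M t -> perm_eq s t.
Proof.
by rewrite /is_spectrum => -> /Pdiv.Field.prod_XsubC_eq.
Qed.

Lemma is_spectrum_size (F : fieldType) (n : nat) (M : 'M[F]_n) (s : seq F) :
  is_spectrum M s -> size s = n.
Proof.
move=> /(congr1 (fun q : {poly F} => size q)).
by rewrite size_char_poly size_prod_XsubC => -[->].
Qed.

Section ZeroDivisorGraph.
Variable K : finComNzRingType.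

Definition zero_divisor (x : K) : bool := [exists y : K, (y != 0) && (x * y == 0)].

Definition zd_adj : rel K := [rel x y | (x != y) && (x * y == 0)].

Fact zd_adj_sym : symmetric zd_adj.
Proof. by move=> x y; rewrite /zd_adj /= eq_sym mulrC. Qed.

Fact zd_adj_irr : irreflexive zd_adj.
Proof. by move=> x; rewrite /zd_adj /= eqxx. Qed.

Definition zd_graph : sgraph K :=
  SGraph [set x | (x != 0) && zero_divisor x] zd_adj_sym zd_adj_irr.

End ZeroDivisorGraph.

(* Joins the finite and the ring structures that qpoly.v declares separately. *)
HB.instance Definition _ (A : finComNzRingType) (h : {poly A}) :=
  Finite.on {poly %/ h}.

Section TruncatedPolynomials.
Variables p b : nat.

(* 'X^(2b + 1) is monic of size > 1, so {poly %/ _} quotients by it and not by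
   its default 'X. *)
Definition truncpoly : finComNzRingType :=
  {poly %/ ('X^(2 * b + 1) : {poly 'F_p})}.

Definition tpx : {poly %/ ('X^(2 * b + 1) : {poly 'F_p})} := in_qpoly _ 'X.

(* The blocks are numbered i = 1, ..., 2b. *)
Definition block (i : nat) : {set truncpoly} :=
  [set f : truncpoly | [exists a : {ffun 'I_(2 * b).+1 -> 'F_p},
     (a (inord i) != 0) &&
     (f == \sum_(k < (2 * b).+1 | (i <= k)%N) a k *: tpx ^+ k)]].

Definition block_card (i : nat) : nat := ((p - 1) * p ^ (2 * b - i))%N.

Definition block_deg (i : nat) : nat :=
  (if i <= b then p ^ i - 1 else p ^ i - 2)%N.

(* Row k : 'I_(2 * b) of the matrices below corresponds to the block k + 1. *)
Definition ix (k : 'I_(2 * b)) : nat := k.+1.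

Definition Qstar (F : fieldType) : 'M[F]_(2 * b) :=
  \matrix_(i, j)
    if i == j then
      (if (ix i <= b)%N then 0 else (block_card (ix i))%:R - 1)
    else
      (if (2 * b + 1 <= ix i + ix j)%N then (block_card (ix j))%:R else 0).

Definition Dstar (F : fieldType) : 'M[F]_(2 * b) :=
  diag_mx (\row_i (block_deg (ix i))%:R).

Definition Bmx (F : fieldType) (alpha : F) : 'M[F]_(2 * b) :=
  alpha *: Dstar F + (1 - alpha) *: Qstar F.

End TruncatedPolynomials.

(* Main.v *)
(** Write each nonzero non-unit of F_p[x]/(x^(2b+1)) as x^i times a unit: x^i u
   annihilates exactly the ideal (x^(2b+1-i)), which gives the blocks, their
   sizes, the degrees and the adjacency rule i + j >= 2b + 1. Hence
   A_alpha = diag(theta_c(k)) + P W P^T, where c(k) is the block of the vertex k,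
   P is the vertex/block incidence matrix, theta_i is alpha d_i for i <= b and
   alpha d_i - (1 - alpha) for i > b; and B = diag(theta) + W P^T P. Comparing two
   block eliminations of one bordered matrix yields
     det(X - A_alpha) prod_j (X - theta_j)
       = prod_j (X - theta_j)^(n_j) det(X - B).
   Finally B splits over the reals because diag(n_i) B is symmetric. *)

Require Import Defs.
From HB Require Import structures.
From mathcomp Require Import all_boot all_order all_algebra.
From mathcomp Require Import qpoly reals.
From mathcomp Require Import complex ring zify.

Set Implicit Arguments.
Unset Strict Implicit.
Unset Printing Implicit Defensive.

Import Order.TTheory GRing.Theory Num.Theory.
Local Open Scope ring_scope.

(** * Linear algebra: characteristic polynomials of block-constant matrices, and real spectra *)

(** Both sides are the determinant of the bordered matrix [L P; V 1] times [\det La]. Left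
    multiplication by a unipotent matrix clears P; right multiplication by [1 -P; 0 La] clears it
    too, thanks to L P = P La. Nothing is inverted, so entries may be polynomials. *)
Lemma det_sub_mulmx_diag (A : comNzRingType) (N m : nat) (L : 'M[A]_N)
    (La : 'M[A]_m) (P : 'M[A]_(N, m)) (V : 'M[A]_(m, N)) :
  L *m P = P *m La ->
  \det (L - P *m V) * \det La = \det L * \det (La - V *m P).
Proof.
move=> LP.
have E1 : block_mx 1%:M (- P) 0 1%:M *m block_mx L P V 1%:M
        = block_mx (L - P *m V) 0 V 1%:M.
  by rewrite mulmx_block !mul1mx !mul0mx !add0r !mulmx1 mulNmx subrr.
have E2 : block_mx L P V 1%:M *m block_mx 1%:M (- P) 0 La
        = block_mx L 0 V (La - V *m P).
  rewrite mulmx_block !mulmx1 !mulmx0 !addr0 !mul1mx !mulmxN LP addNr.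
  by rewrite (addrC (- _)).
have := congr1 determinant E1; have := congr1 determinant E2.
rewrite !det_mulmx !det_ublock !det_lblock !det1 !mul1r !mulr1 => E3 <-.
exact: E3.
Qed.

(** The determinant identity is used over F[X], with P the incidence matrix of c and [V] standing
    for W P^T. The extra factor prod_j (X - theta_j) is a nonzero polynomial; cancelling it lowers
    each exponent n_j by one. *)
Lemma char_poly_equitable (F : fieldType) (N m : nat) (c : 'I_N -> 'I_m)
    (theta : 'I_m -> F) (W : 'M[F]_m) :
  let n_ j := #|[set k | c k == j]| in
  (forall j, (0 < n_ j)%N) ->
  char_poly (\matrix_(k, l) (theta (c k) *+ (k == l) + W (c k) (c l)))
  = (\prod_j ('X - (theta j)%:P) ^+ (n_ j - 1))
    * char_poly (\matrix_(i, j) (theta i *+ (i == j) + W i j * (n_ j)%:R)).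
Proof.
move=> n_ n_gt0.
pose L : 'M[{poly F}]_N := diag_mx (\row_k ('X - (theta (c k))%:P)).
pose La : 'M[{poly F}]_m := diag_mx (\row_j ('X - (theta j)%:P)).
pose P : 'M[{poly F}]_(N, m) := \matrix_(k, j) (c k == j)%:R.
pose V : 'M[{poly F}]_(m, N) := \matrix_(i, l) (W i (c l))%:P.
have LP : L *m P = P *m La.
  apply/matrixP=> k j; rewrite mul_diag_mx mul_mx_diag !mxE.
  by case: eqP => [->|_]; rewrite ?mulr0 ?mul0r // mulr1 mul1r.
have PV k l : (P *m V) k l = (W (c k) (c l))%:P.
  rewrite mxE (bigD1 (c k)) //= !mxE eqxx mul1r big1 ?addr0 // => j.
  by rewrite !mxE eq_sym => /negPf ->; rewrite mul0r.
have VP i j : (V *m P) i j = (W i j)%:P * (n_ j)%:R.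
  rewrite mxE /n_ -sum1_card natr_sum mulr_sumr.
  rewrite [RHS]big_mkcond; apply: eq_bigr => l _; rewrite !mxE inE.
  by case: eqP => [->|_]; rewrite ?mulr1 ?mulr0.
have E1 : char_poly_mx (\matrix_(k, l) (theta (c k) *+ (k == l)
            + W (c k) (c l))) = L - P *m V.
  apply/matrixP=> k l; rewrite [RHS]mxE [X in _ = _ + X]mxE PV !mxE.
  by case: eqP => [->|_]; rewrite ?mulr1n ?mulr0n ?add0r // polyCD opprD addrA.
have E2 : char_poly_mx (\matrix_(i, j) (theta i *+ (i == j)
            + W i j * (n_ j)%:R)) = La - V *m P.
  apply/matrixP=> i j; rewrite [RHS]mxE [X in _ = _ + X]mxE VP !mxE.
  rewrite -polyC_natr -polyCM.
  by case: eqP => [->|_]; rewrite ?mulr1n ?mulr0n ?add0r // polyCD opprD addrA.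
have detL : \det L = \prod_j ('X - (theta j)%:P) ^+ n_ j.
  rewrite det_diag (partition_big c predT) //=; apply: eq_bigr => j _.
  rewrite -prodr_const; apply: eq_big => [k|k /eqP <-]; last by rewrite mxE.
  by rewrite inE.
have detLa : \det La = \prod_j ('X - (theta j)%:P).
  by rewrite det_diag; apply: eq_bigr => j _; rewrite mxE.
have La0 : \det La != 0.
  by rewrite detLa; apply/prodf_neq0 => j _; rewrite polyXsubC_eq0.
apply: (mulIf La0); rewrite /char_poly E1 E2 det_sub_mulmx_diag //.
rewrite mulrAC; congr (_ * _); rewrite detL detLa -big_split /=.
by apply: eq_bigr => j _; rewrite -exprSr subn1 prednK.
Qed.

(* If z is an eigenvalue with eigenvector v, the Hermitian form
   sum v_i B_ij conj(v_j) / w_j is both real and equal to z times a positive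
   number. *)
Lemma spectrum_of_symmetrizable (R : rcfType) (m : nat) (B : 'M[R]_m)
    (w : 'I_m -> R) :
  (forall i, 0 < w i) -> (forall i j, w i * B i j = w j * B j i) ->
  exists s, is_spectrum B s.
Proof.
move=> w_gt0 wB; pose cc : R -> R[i] := real_complex R.
have ccR x : (cc x)^* = cc x by apply: conj_Creal; apply/complex_realP; exists x.
pose BC := map_mx (real_complex R) B.
have [r] := closed_field_poly_normal (char_poly BC).
rewrite (monicP (char_poly_monic _)) scale1r => rE.
have r_real z : z \in r -> z \is Num.real.
  rewrite -root_prod_XsubC -rE -eigenvalue_root_char => /eigenvalueP[v vB v0].
  pose H := \sum_i \sum_j v 0 i * BC i j * (v 0 j)^* / cc (w j).
  pose n2 := \sum_j v 0 j * (v 0 j)^* / cc (w j).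
  have wC j : 0 < cc (w j) by rewrite ltcR.
  have n2_ge0 j : 0 <= v 0 j * (v 0 j)^* / cc (w j).
    by rewrite divr_ge0 ?mul_conjC_ge0 ?ltW.
  have n2_gt0 : 0 < n2.
    rewrite lt_def sumr_ge0 // andbT psumr_neq0 //.
    have /rV0Pn[j vj] := v0; apply/hasP; exists j.
      by rewrite mem_index_enum.
    by rewrite /= divr_gt0 ?mul_conjC_gt0.
  have HE : H = z * n2.
    (* Since v is a row eigenvector, the inner sum over i is entry j of v B, that is z v_j. *)
    rewrite /H exchange_big mulr_sumr; apply: eq_bigr => j _ /=.
    have := congr1 (fun u : 'rV_m => u 0 j) vB; rewrite !mxE => E.
    by rewrite -!mulr_suml E !mulrA.
  have H_real : H \is Num.real.
    (* Conjugation exchanges the roles of i and j, and the hypothesis on w says that B_ij / w_j =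
       B_ji / w_i. *)
    apply/CrealP; rewrite rmorph_sum /H exchange_big; apply: eq_bigr => i _ /=.
    rewrite rmorph_sum; apply: eq_bigr => j _ /=.
    rewrite !rmorphM /= conjCK fmorphV /= ccR !mxE /= -!/(cc _) ccR.
    have -> : cc (B j i) = cc (w i) * cc (B i j) / cc (w j).
      rewrite -rmorphM wB rmorphM mulrAC mulfV ?mul1r //.
      by rewrite gt_eqF.
    have := wC i; have := wC j; move: (cc (w i)) (cc (w j)) => a c a0 c0.
    by rewrite !mulrA mulrAC [_ * v 0 j]mulrC; field; rewrite !gt_eqF.
  have -> : z = H / n2 by rewrite HE mulfK // gt_eqF.
  by rewrite realM // realV gtr0_real.
(* All complex roots are real, so the factorization descends along the injection of R into R[i]. *)
exists (map (@complex.Re R) r); apply: (map_inj_poly (@complexI R) (rmorph0 _)).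
rewrite map_char_poly -/BC rE big_map rmorph_prod big_seq [RHS]big_seq.
apply: eq_bigr => z zr; rewrite /= map_polyXsubC /=.
by rewrite RRe_real // r_real.
Qed.

(** * Divisibility by powers of X *)

Lemma dvdXnP (F : fieldType) (i : nat) (g : {poly F}) :
  reflect (forall k, (k < i)%N -> g`_k = 0) ('X^i %| g).
Proof.
apply: (iffP (dvdpP _ _)) => [[q ->] k ki|g0]; first by rewrite coefMXn ki.
exists (drop_poly i g); rewrite -[LHS](poly_take_drop i).
rewrite [take_poly i g](_ : _ = 0) ?add0r //.
apply/polyP => k; rewrite coef_take_poly coef0.
by case: ltnP => // /g0.
Qed.

Lemma dvdXnS (F : fieldType) (i : nat) (g : {poly F}) :
  ('X^(i.+1) %| g) = ('X^i %| g) && (g`_i == 0).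
Proof.
apply/dvdXnP/andP => [g0|[/dvdXnP g0 /eqP gi] k].
  by split; [apply/dvdXnP => k ki; apply/g0/ltnW | rewrite g0].
by rewrite ltnS leq_eqVlt => /orP[/eqP ->|/g0].
Qed.

(** Here f = q X^i with q(0) != 0, so q is coprime to X and drops out of the divisibility. *)
Lemma dvdXn_mul (F : fieldType) (n i : nat) (f g : {poly F}) :
  (i <= n)%N -> 'X^i %| f -> f`_i != 0 ->
  ('X^n %| f * g) = ('X^(n - i) %| g).
Proof.
move=> ni /dvdpP[q ->]; rewrite coefMXn ltnn subnn => q0.
rewrite mulrAC -{1}(subnK ni) exprD dvdp_mul2r ?monic_neq0 ?monicXn //.
rewrite Gauss_dvdpr // coprimep_expl // coprimep_sym.
by rewrite -['X]subr0 -polyC0 coprimep_XsubC /root horner_coef0.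
Qed.

(** * The ideals (x^i) of the truncated polynomial ring, and the blocks as layers between them *)

Section TruncatedPolynomials.
Variables p b : nat.
Local Notation n := (2 * b).+1.
Local Notation R := (truncpoly p b).

Lemma mk_monic_trunc : mk_monic ('X^(2 * b + 1) : {poly 'F_p}) = 'X^n.
Proof. by rewrite mk_monic_Xn addn1. Qed.

Lemma size_trunc (f : R) : (size (f : {poly 'F_p}) <= n)%N.
Proof.
have := size_mk_monic f; rewrite [in X in (_ < size X)%N]mk_monic_trunc.
by rewrite size_polyXn ltnS.
Qed.

Lemma trunc_mul_eq0 (f g : R) :
  (f * g == 0) = ('X^n %| (f : {poly 'F_p}) * (g : {poly 'F_p})).
Proof.
rewrite -val_eqE /=; move: (polyn f) (polyn g) => F G; rewrite mk_monic_trunc.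
by rewrite dvdpE.
Qed.

(** The ideal (x^i), read on reduced representatives of size at most n; i = n gives the zero
    ideal. *)
Definition Xideal (i : nat) : {set R} :=
  [set f : R | 'X^i %| (f : {poly 'F_p})].

Lemma card_Xideal (i : nat) : prime p -> (i <= n)%N ->
  #|Xideal i| = (p ^ (n - i))%N.
Proof.
move=> p_prime ni.
have -> : (p ^ (n - i) = #|{poly_(n - i) 'F_p}|)%N.
  by rewrite card_npoly card_Fp.
(* Multiplication by X^i maps polynomials of size at most n - i bijectively onto the ideal; the
   product is already reduced. *)
pose phi (g : {poly_(n - i) 'F_p}) : R := in_qpoly _ ((g : {poly 'F_p}) * 'X^i).
have phiE g : phi g = (g : {poly 'F_p}) * 'X^i :> {poly 'F_p}.
  rewrite in_qpoly_small // mk_monic_trunc size_polyXn ltnS.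
  rewrite (leq_trans (size_polyMleq _ _)) // size_polyXn addnS /=.
  by rewrite -[X in (_ <= X)%N](subnK ni) leq_add2r size_npoly.
have phi_inj : injective phi.
  move=> g h E; have : polyn (phi g) = polyn (phi h) by rewrite E.
  rewrite !phiE => /mulIf gh; apply/val_inj/gh.
  by rewrite monic_neq0 ?monicXn.
rewrite -(card_imset _ phi_inj); apply: eq_card => f; rewrite inE.
apply/idP/imsetP => [/dvdpP[q fE]|[g _ ->]]; last by rewrite phiE dvdp_mull.
have sq : (size q <= n - i)%N.
  have [->|q0] := eqVneq q 0; first by rewrite size_poly0.
  have := size_trunc f; rewrite fE size_mulXn // addnC => sqi.
  by rewrite -(leq_add2r i) subnK.
exists (npolyp _ q) => //.
by apply/val_inj/esym; rewrite [LHS]phiE npolypK.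
Qed.

Lemma tpxX (k : nat) : (k < n)%N -> tpx p b ^+ k = 'X^k :> {poly 'F_p}.
Proof.
move=> kn; rewrite /tpx -rmorphXn in_qpoly_small //.
by rewrite mk_monic_trunc !size_polyXn ltnS.
Qed.

(** The sums defining a block are already reduced, so the coefficients a_k with k >= i are those of
    the representative of f. Membership thus means that f has X-adic valuation exactly i. *)
Lemma mem_block (i : nat) (f : R) : (i <= 2 * b)%N ->
  (f \in block p b i) =
  ('X^i %| (f : {poly 'F_p})) && ((f : {poly 'F_p})`_i != 0).
Proof.
move=> ib; rewrite inE.
have sumE (a : {ffun 'I_n -> 'F_p}) :
  polyn (\sum_(k < n | (i <= k)%N) a k *: tpx p b ^+ k
    : {poly %/ 'X^(2 * b + 1)}) =
  \poly_(k < n) (if (i <= k)%N then a (inord k) else 0).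
  rewrite poly_of_qpoly_sum poly_def big_mkcond; apply: eq_bigr => k _.
  case: ifP => _; last by rewrite scale0r.
  by rewrite poly_of_qpolyZ tpxX // inord_val.
have coefE (a : {ffun 'I_n -> 'F_p}) k :
  (\poly_(k < n) (if (i <= k)%N then a (inord k) else 0) : {poly 'F_p})`_k =
  if (i <= k < n)%N then a (inord k) else 0.
  by rewrite coef_poly andbC; case: ifP.
apply/existsP/andP => [[a /andP[ai /eqP ->]]|[/dvdXnP f0 fi]].
  rewrite sumE coefE leqnn ltnS ib ai; split=> //.
  by apply/dvdXnP => k ki; rewrite coefE leqNgt ki.
exists [ffun k : 'I_n => (f : {poly 'F_p})`_k].
rewrite ffunE inordK ?ltnS // fi /= -val_eqE /= sumE; apply/eqP/polyP => k.
rewrite coefE ffunE; case: ifP => [/andP[_ kn]|]; first by rewrite inordK.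
move/negbT; rewrite negb_and -leqNgt -ltnNge => /orP[ki|nk]; first exact: f0.
by rewrite nth_default // (leq_trans (size_trunc f)).
Qed.

Lemma block_Xideal (i : nat) : (i <= 2 * b)%N ->
  block p b i = Xideal i :\: Xideal i.+1.
Proof.
move=> ib; apply/setP => f; rewrite mem_block // !inE dvdXnS negb_and.
by case: (_ %| _) => //=; rewrite ?orbF ?andbF ?andbT.
Qed.

Lemma mem_Xideal_block (i k : nat) (f : R) : (i <= 2 * b)%N ->
  f \in block p b i -> (f \in Xideal k) = (k <= i)%N.
Proof.
move=> ib; rewrite mem_block // inE => /andP[/dvdXnP f0 fi].
apply/dvdXnP/idP => [fk|ki j jk]; last by rewrite f0 // (leq_trans jk).
by rewrite leqNgt; apply: contra fi => /fk ->.
Qed.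

Lemma block_neq0 (i : nat) (f : R) : (i <= 2 * b)%N ->
  f \in block p b i -> f != 0.
Proof.
move=> ib; rewrite mem_block // => /andP[_]; apply: contraNneq => ->.
by rewrite coef0.
Qed.

(** The annihilator of f depends only on its valuation, whence degrees and adjacency are constant on
    blocks. The case i = 0 covers the units. *)
Lemma mul_block_eq0 (i : nat) (f g : R) : (i <= 2 * b)%N ->
  f \in block p b i -> (f * g == 0) = (g \in Xideal (n - i)).
Proof.
move=> ib; rewrite mem_block // => /andP[fi fi0].
by rewrite trunc_mul_eq0 (dvdXn_mul _ _ fi) ?inE // leqW.
Qed.

Lemma block_disjoint (i j : nat) : (i <= 2 * b)%N -> (j <= 2 * b)%N ->
  i != j -> [disjoint block p b i & block p b j].
Proof.
move=> ib jb; apply: contra_neqT => /pred0Pn[f /andP[/= fi fj]].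
apply/eqP; rewrite eqn_leq.
rewrite -(mem_Xideal_block _ jb fj) -(mem_Xideal_block _ ib fi).
by rewrite (mem_Xideal_block _ ib fi) (mem_Xideal_block _ jb fj) !leqnn.
Qed.

Lemma card_block (i : nat) : prime p -> (i <= 2 * b)%N ->
  #|block p b i| = block_card p b i.
Proof.
move=> p_prime ib; rewrite block_Xideal // cardsD (setIidPr _); last first.
  by apply/subsetP => f; rewrite !inE dvdXnS => /andP[].
rewrite card_Xideal ?leqW // card_Xideal // subSS subSn // /block_card.
by rewrite expnS mulnBl mul1n.
Qed.

Lemma block_cover (f : R) : f != 0 -> f \in Xideal 1 ->
  exists k : 'I_(2 * b), f \in block p b (ix k).
Proof.
move=> f0; rewrite inE => /dvdXnP f1.
have ex_i : exists i, (f : {poly 'F_p})`_i != 0.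
  by exists (size (f : {poly 'F_p})).-1; rewrite -/(lead_coef _) lead_coef_eq0.
(* The block is given by the valuation of f; its row index is one less, because [ix] adds 1. *)
case: (ex_minnP ex_i) => i fi min_i.
have i_gt0 : (0 < i)%N by rewrite lt0n; apply: contraNneq fi => ->; rewrite f1.
have i_le : (i <= 2 * b)%N.
  rewrite leqNgt; apply: contra fi => ni.
  by rewrite nth_default // (leq_trans (size_trunc f)).
have ib : (i.-1 < 2 * b)%N by rewrite prednK.
exists (Ordinal ib); rewrite /ix /= prednK // mem_block // fi andbT.
by apply/dvdXnP => k; rewrite ltnNge; apply: contraNeq => /min_i.
Qed.

(** * Vertices, degrees and adjacency of the zero-divisor graph *)

Lemma vertices_Xideal : vertices (zd_graph R) = Xideal 1 :\ 0.
Proof.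
apply/setP => f; rewrite !inE; have [//|f0] := eqVneq f 0.
apply/existsP/idP => [[g /andP[g0 fg]]|f1] /=.
  (* A nonzero constant term would put f in block 0, whose annihilator is (x^n) = 0, forcing g =
     0. *)
  rewrite dvdXnS expr0 dvd1p /=; apply: contraNT g0 => f_0.
  move: fg; rewrite (@mul_block_eq0 0) ?mem_block ?dvd1p //.
  rewrite inE subn0 => /dvdXnP g0; apply/eqP/val_inj/polyP => k /=.
  rewrite coef0; case: (ltnP k n) => [/g0 //|nk].
  by rewrite nth_default // (leq_trans (size_trunc g)).
have [|k fk] := block_cover f0; first by rewrite inE.
(* As [ix k] is at least 1, the power x^(n - [ix k]) is nonzero; it is the required annihilating
   element. *)
have kn : (n - ix k < n)%N by rewrite /ix; have := ltn_ord k; lia.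
exists (tpx p b ^+ (n - ix k)); rewrite (mul_block_eq0 _ _ fk) ?ltn_ord //.
rewrite inE tpxX // dvdpp andbT -val_eqE /= tpxX //.
by rewrite monic_neq0 ?monicXn.
Qed.

Lemma vertices_block :
  vertices (zd_graph R) = \bigcup_(k < 2 * b) block p b (ix k).
Proof.
apply/setP => f; rewrite vertices_Xideal in_setD1.
apply/andP/bigcupP => [[f0 /(block_cover f0)[k fk]]|[k _ fk]].
  by exists k.
by rewrite (block_neq0 _ fk) ?(mem_Xideal_block _ _ fk) ?ltn_ord.
Qed.

(** The neighbours of f form its annihilator (x^(n-i)), of size p^i, without 0 and without f. The
    element f lies in its own annihilator exactly when n - i <= i, that is i > b; hence the two
    cases of [block_deg]. *)
Lemma degree_block (i : nat) (f : R) : prime p -> (1 <= i <= 2 * b)%N ->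
  f \in block p b i -> degree (zd_graph R) f = block_deg p b i.
Proof.
move=> p_prime /andP[i_gt0 ib] fi; rewrite /degree vertices_Xideal.
have -> : [set y in Xideal 1 :\ 0 | adj (zd_graph R) f y]
       = (Xideal (n - i) :\ 0) :\ f.
  apply/setP => g; rewrite [LHS]in_set !in_setD1 /= /zd_adj /=.
  rewrite (mul_block_eq0 _ ib fi).
  rewrite (eq_sym f); case: (g =P f) => _ /=; rewrite ?andbF //.
  case: (g == 0) => //=; rewrite andbC.
  case: (boolP (g \in Xideal (n - i))) => //; rewrite !inE => gi.
  apply: dvdp_trans gi; apply: dvdp_exp2l; lia.
have := cardsD1 f (Xideal (n - i) :\ 0); have := cardsD1 0 (Xideal (n - i)).
rewrite inE dvdp0 card_Xideal ?leq_subr // subKn ?leqW //.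
rewrite in_setD1 (block_neq0 ib fi) (mem_Xideal_block _ ib fi) /block_deg.
have -> : (n - i <= i)%N = ~~ (i <= b)%N by lia.
by case: (i <= b)%N => /= -> ->; lia.
Qed.

Lemma adj_block (i j : nat) (f g : R) : (i <= 2 * b)%N -> (j <= 2 * b)%N ->
  f \in block p b i -> g \in block p b j ->
  zd_adj f g = (f != g) && (2 * b + 1 <= i + j)%N.
Proof.
move=> ib jb fi gj; rewrite /zd_adj /= (mul_block_eq0 _ ib fi).
by rewrite (mem_Xideal_block _ jb gj) addn1 leq_subLR.
Qed.

(** This makes the partition equitable: the sum depends only on the block of f. On the diagonal, f
    is not its own neighbour, which accounts for the -1 when [ix i] exceeds b. *)
Lemma sum_adj_block (F : fieldType) (i j : 'I_(2 * b)) (f : R) :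
  prime p -> f \in block p b (ix i) ->
  \sum_(g in block p b (ix j)) (zd_adj f g)%:R = Qstar p b F i j.
Proof.
move=> p_prime fi; rewrite mxE; have [<-|neq_ij] := eqVneq i j.
  rewrite (eq_bigr (fun g => ((f != g) && (2 * b + 1 <= ix i + ix i)%N)%:R)).
    rewrite (bigD1 f) //= eqxx add0r.
    rewrite (eq_bigr (fun=> (2 * b + 1 <= ix i + ix i)%N%:R))
      => [|g /andP[_ gf]].
      rewrite sumr_const.
      have -> : (2 * b + 1 <= ix i + ix i)%N = ~~ (ix i <= b)%N by lia.
      case: ifP => _ /=; first by rewrite mul0rn.
      rewrite -card_block ?ltn_ord // (cardsD1 f) fi natrD.
      rewrite [RHS]addrAC subrr add0r.
      by congr (_ *+ _); apply: eq_card => g; rewrite in_setD1 andbC.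
    by rewrite eq_sym gf.
  by move=> g gi; rewrite (adj_block _ _ fi gi) ?ltn_ord.
rewrite (eq_bigr (fun=> (2 * b + 1 <= ix i + ix j)%N%:R)) => [|g gj].
  rewrite sumr_const card_block ?ltn_ord //.
  by case: ifP; rewrite ?mul0rn.
rewrite (adj_block _ _ fi gj) ?ltn_ord //.
suff -> : f != g by [].
apply: contraTneq gj => <-.
by rewrite (disjointFr (block_disjoint _ _ _) fi) ?ltn_ord.
Qed.

End TruncatedPolynomials.

(** * Assembling the spectrum *)

Lemma sum_enum_val (V : nmodType) (T : finType) (A B : {set T}) (F : T -> V) :
  B \subset A ->
  \sum_(k < #|A| | enum_val k \in B) F (enum_val k) = \sum_(x in B) F x.
Proof.
move=> BA; rewrite -(big_enum_val_cond (fun x => x \in B)).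
by apply: eq_bigl => x; apply: andb_idl; apply: (subsetP BA).
Qed.

Lemma block_sub_vertices (p b : nat) (k : 'I_(2 * b)) :
  block p b (ix k) \subset vertices (zd_graph (truncpoly p b)).
Proof. by rewrite vertices_block; apply: bigcup_sup. Qed.

Lemma block_card_gt0 (p b i : nat) : prime p -> (0 < block_card p b i)%N.
Proof.
by move=> p_prime; rewrite muln_gt0 subn_gt0 prime_gt1 // expn_gt0 prime_gt0.
Qed.

(** For i > b, alpha (p^i - 2) - (1 - alpha) = alpha (p^i - 1) - 1, so [theta] is the diagonal alpha
    d_i corrected for the absent loops. *)
Lemma char_poly_Aalpha (F : fieldType) (p b : nat) (alpha : F) :
  prime p ->
  let theta i : F := alpha * ((p ^ i)%:R - 1) - (b < i)%N%:R in
  char_poly (Aalpha (zd_graph (truncpoly p b)) alpha) =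
  (\prod_(i < 2 * b) ('X - (theta (ix i))%:P) ^+ (block_card p b (ix i) - 1))
  * char_poly (Bmx p b alpha).
Proof.
move=> p_prime theta; set G := zd_graph _.
have [c cP] : exists c : 'I_#|vertices G| -> 'I_(2 * b),
    forall k, enum_val k \in block p b (ix (c k)).
  apply: (@fin_all_exists _ _
    (fun k (i : 'I_(2 * b)) => enum_val k \in block p b (ix i))) => k.
  move: (enum_val k) (enum_valP k) => f.
  rewrite vertices_block // => /bigcupP[i _ fi].
  by exists i.
have cE k j : (enum_val k \in block p b (ix j)) = (c k == j).
  apply/idP/eqP => [kj|<- //]; apply: contraTeq kj => ne.
  by rewrite (disjointFr (block_disjoint _ _ _ _) (cP k)) ?ltn_ord.
have n_E j : #|[set k | c k == j]| = block_card p b (ix j).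
  rewrite -card_block ?ltn_ord // -!sum1_card.
  rewrite (eq_bigl (fun k => enum_val k \in block p b (ix j))); last first.
    by move=> k; rewrite inE cE.
  rewrite (sum_enum_val (fun=> 1%N) (block_sub_vertices p j)).
  exact: sum1_card.
have p_ge i : (0 < p ^ i)%N by rewrite expn_gt0 prime_gt0.
(* This bound makes the truncated subtraction p^i - 2 in [block_deg] a true one in F. *)
have p_ge2 i : (0 < i)%N -> (1 < p ^ i)%N.
  by move=> i0; rewrite -(exp1n i) ltn_exp2r // prime_gt1.
have thetaE (i : 'I_(2 * b)) : theta (ix i) =
    alpha * (block_deg p b (ix i))%:R
    - (1 - alpha) * (2 * b + 1 <= ix i + ix i)%N%:R.
  have -> : (2 * b + 1 <= ix i + ix i)%N = ~~ (ix i <= b)%N by lia.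
  rewrite /theta /block_deg ltnNge; case: ifP => _ /=.
    by rewrite natrB //; ring.
  by rewrite natrB ?p_ge2 //; ring.
(* [W] depends on blocks only, as if vertices of blocks i > b carried loops; [theta] takes these
   back. *)
pose W : 'M[F]_(2 * b) :=
  \matrix_(i, j) ((1 - alpha) * (2 * b + 1 <= ix i + ix j)%N%:R).
have AE : Aalpha G alpha = \matrix_(k, l)
    (theta (ix (c k)) *+ (k == l) + W (c k) (c l)).
  apply/matrixP => k l; rewrite !mxE.
  rewrite /G /= (adj_block _ _ (cP k) (cP l)) ?ltn_ord //.
  rewrite (inj_eq enum_val_inj) (degree_block _ _ (cP k)) ?ltn_ord //.
  by have [<-|_] := eqVneq k l; rewrite /= ?mulr1n ?thetaE ?mulr0n; ring.
rewrite [char_poly _](congr1 _ AE).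
rewrite (char_poly_equitable (c := c) (fun i => theta (ix i))); last first.
  by move=> j; rewrite n_E block_card_gt0.
congr (_ * _); first by apply: eq_bigr => j _; rewrite n_E.
congr char_poly.
apply/matrixP => i j; rewrite !mxE n_E thetaE.
have [<-|_] := eqVneq i j; last first.
  by case: ifP => _; rewrite ?mulr1n ?mulr0n; ring.
have -> : (2 * b + 1 <= ix i + ix i)%N = ~~ (ix i <= b)%N by lia.
by case: ifP => _ /=; rewrite ?mulr1n; ring.
Qed.

(** Off the diagonal, n_i B_ij is (1 - alpha) n_i n_j or 0, under a condition symmetric in i and j;
    so the block sizes serve as weights. *)
Lemma Bmx_spectrum (R : rcfType) (p b : nat) (alpha : R) :
  prime p -> exists s, is_spectrum (Bmx p b alpha) s.
Proof.
move=> p_prime.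
apply: (@spectrum_of_symmetrizable _ _ _ (fun i => (block_card p b (ix i))%:R)).
  by move=> i; rewrite ltr0n block_card_gt0.
move=> i j; rewrite !mxE [j == i]eq_sym [(ix j + _)%N]addnC.
have [<- //|_] := eqVneq i j.
by case: ifP => _; rewrite ?mulr0n; ring.
Qed.

Lemma prod_nseq_XsubC (F : fieldType) (n : nat) (a : F) :
  \prod_(z <- nseq n a) ('X - z%:P) = ('X - a%:P) ^+ n.
Proof. by rewrite big_nseq iter_mulr_1. Qed.

Theorem theorem3p2 (R : realType) (p b : nat) (alpha : R)
    (p_prime : prime p) (b_ge1 : (1 <= b)%N) (alpha01 : 0 <= alpha <= 1) :
  let G := zd_graph (truncpoly p b) in
  let n_ := block_card p b in
  [/\ vertices G = \bigcup_(k < 2 * b) block p b (ix k),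
      (forall k l : 'I_(2 * b), k != l ->
         [disjoint block p b (ix k) & block p b (ix l)]),
      (forall i : nat, (1 <= i <= 2 * b)%N -> #|block p b i| = n_ i),
      (forall (i : nat) (x : truncpoly p b), (1 <= i <= 2 * b)%N ->
         x \in block p b i -> degree G x = block_deg p b i)
    & quotient_mx (adjmx R G) (fun k => block p b (ix k)) = Qstar p b R]
  /\
  exists sB : seq R,
    is_spectrum (Bmx p b alpha) sB /\
    is_spectrum (Aalpha G alpha)
      (flatten [seq nseq (n_ i - 1) (alpha * ((p ^ i)%:R - 1))
                 | i <- index_iota 1 b.+1]
       ++ flatten [seq nseq (n_ i - 1) (alpha * ((p ^ i)%:R - 1) - 1)
                 | i <- index_iota b.+1 (2 * b).+1]
       ++ sB).
Proof.
move=> G n_; split.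
  split.
  - exact: vertices_block.
  - by move=> k l kl; apply: block_disjoint; rewrite ?ltn_ord.
  - by move=> i /andP[_]; apply: card_block.
  - by move=> i f; apply: degree_block.
  (* All rows of a block have the same sum, so their average is that sum; nonemptiness makes the
     division genuine. *)
  apply/matrixP => i j; rewrite mxE.
  have n_gt0 : (0 < #|block p b (ix i)|)%N.
    by rewrite card_block ?ltn_ord // block_card_gt0.
  have sub (k : 'I_(2 * b)) := block_sub_vertices p k.
  rewrite (eq_bigr (fun=> Qstar p b R i j)) => [|k ki]; last first.
    rewrite -(sum_adj_block _ _ _ ki) // -(sum_enum_val _ (sub j)).
    by apply: eq_bigr => l _; rewrite mxE.
  rewrite (sum_enum_val (fun=> Qstar p b R i j) (sub i)) sumr_const.
  rewrite -[_ *+ _]mulr_natr mulfK //.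
  by rewrite pnatr_eq0 -lt0n.
have [sB BsB] := Bmx_spectrum b alpha p_prime.
exists sB; split=> //; rewrite /is_spectrum char_poly_Aalpha // BsB.
rewrite !big_cat /= mulrA !big_flatten !big_map; congr (_ * _).
pose th i := alpha * ((p ^ i)%:R - 1) - (b < i)%N%:R.
(* The product is reindexed from 0..2b-1 to 1..2b and split at b + 1, where the indicator of b < i
   in [th] switches from 0 to 1. *)
rewrite -(big_mkord xpredT (fun i => ('X - (th i.+1)%:P) ^+ (n_ i.+1 - 1))).
rewrite -(big_add1 _ _ 0 (2 * b).+1 xpredT
  (fun i => ('X - (th i)%:P) ^+ (n_ i - 1))).
rewrite [LHS](@big_cat_nat _ _ _ b.+1) //=; last lia.
congr (_ * _); apply: eq_big_nat => i /andP[i1 i2]; rewrite prod_nseq_XsubC /th.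
  by rewrite ltnNge -ltnS i2 subr0.
by rewrite i1.
Qed.
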